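(* Let $\mathrm{CS}$ be an arbitrary constant specification for $\mathsf{JTO}$. Define $$\mathtt{PsueE}:=\boxdot\big[\langle\mathtt a\rangle^{\mathcal P}_p\mathtt{sue}_p\leftrightarrow(\mathsf Y_s(\neg\mathtt{pay}\,\mathcal S\,\mathtt{winfirst}_e)\wedge\neg\mathtt{pay})\big].$$ Then from the assumptions $$\mathtt{true}_{10}(\mathtt{winfirst}_e),\quad \mathtt{true}_{15}(\blacksquare\neg\mathtt{pay}),\quad \mathtt{PsueE},\quad \mathtt{true}_{15}\big[(\mathsf Y_s(\neg\mathtt{pay}\,\mathcal S\,\mathsf Y_w\mathtt{winfirst}_e)\wedge\neg\mathtt{pay})\to\mathtt{winsecond}_p\big]$$ one can derive, by $\vdash_{\mathrm{CS}}$, the formula $\mathtt{true}_{15}(\mathtt{winsecond}_p)$.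
   Context: **Language.** The set of agents is $\mathrm{Ag}=\{p,e,j\}$ (Protagoras, Euathlus, judge); $\mathrm{Const},\mathrm{Var},\mathrm{Prop}$ are countable sets of justification constants, justification variables and atomic propositions. $\mathrm{Prop}$ contains distinct atoms $\mathtt{winfirst}_e$, $\mathtt{pay}$, $\mathtt{sue}_p$, $\mathtt{winsecond}_p$, and $\mathrm{Var}$ contains a variable $\mathtt a$ (the agreement). Epistemic terms: $t::=c\mid x\mid {!t}\mid t+t\mid t\cdot t$. Normative terms: $s::=c\mid x\mid \ddagger s\mid s\cdot s$ ($c\in\mathrm{Const}$, $x\in\mathrm{Var}$). Formulas: $\varphi::=q\mid\bot\mid\varphi\to\varphi\mid\bigcirc\varphi\mid\mathsf Y_w\varphi\mid\varphi\,\mathcal U\,\varphi\mid\varphi\,\mathcal S\,\varphi\mid[t]_i\varphi\mid[s]^{\mathcal O}_i\varphi$ ($q\in\mathrm{Prop}$, $i\in\mathrm{Ag}$, $t$ epistemic, $s$ normative). Unary connectives bind tighter than $\mathcal S,\mathcal U$. Abbreviations: $\neg\varphi:=\varphi\to\bot$, $\top:=\neg\bot$, $\varphi\vee\psi:=\neg\varphi\to\psi$, $\varphi\wedge\psi:=\neg(\neg\varphi\vee\neg\psi)$, $\leftrightarrow$ as usual, $\mathsf Y_s\varphi:=\neg\mathsf Y_w\neg\varphi$, $\Diamond\varphi:=\top\,\mathcal U\,\varphi$, $\Box\varphi:=\neg\Diamond\neg\varphi$, $\blacksquare\varphi:=\neg(\top\,\mathcal S\,\neg\varphi)$, $\boxdot\varphi:=\blacksquare\varphi\wedge\Box\varphi$,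 $\langle s\rangle^{\mathcal P}_i\varphi:=\neg[s]^{\mathcal O}_i\neg\varphi$; for $m\in\mathbb N$, $(\mathtt{time}=m):=\mathsf Y_s^m\mathsf Y_w\bot$ ($m$-fold $\mathsf Y_s$) and $\mathtt{true}_m(\varphi):=\boxdot(\mathtt{time}=m\to\varphi)$. **Axioms** (all instances, all $i\in\mathrm{Ag}$): propositional tautologies; $\ast(\varphi\to\psi)\to(\ast\varphi\to\ast\psi)$ for $\ast\in\{\bigcirc,\Box,\blacksquare,\mathsf Y_w\}$; $\bigcirc\neg\varphi\leftrightarrow\neg\bigcirc\varphi$; $\Box(\varphi\to\bigcirc\varphi)\to(\varphi\to\Box\varphi)$; $\varphi\,\mathcal U\,\psi\to\Diamond\psi$; $\varphi\,\mathcal U\,\psi\leftrightarrow\psi\vee(\varphi\wedge\bigcirc(\varphi\,\mathcal U\,\psi))$; $\mathsf Y_s\varphi\to\mathsf Y_w\varphi$; $\top\,\mathcal S\,\mathsf Y_w\bot$; $\blacksquare(\varphi\to\mathsf Y_w\varphi)\to(\varphi\to\blacksquare\varphi)$; $(\varphi\,\mathcal S\,\psi)\to(\top\,\mathcal S\,\psi)$; $\varphi\,\mathcal S\,\psi\leftrightarrow\psi\vee(\varphi\wedge\mathsf Y_s(\varphi\,\mathcal S\,\psi))$; $\varphi\to\bigcirc\mathsf Y_s\varphi$; $\varphi\to\mathsf Y_w\bigcirc\varphi$; $[t]_i(\varphi\to\psi)\to([s]_i\varphi\to[t\cdot s]_i\psi)$; $[t]_i\varphi\to[t+s]_i\varphi$;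 $[s]_i\varphi\to[t+s]_i\varphi$; $[t]_i\varphi\to\varphi$; $[t]_i\varphi\to[!t]_i[t]_i\varphi$; $[t]^{\mathcal O}_i(\varphi\to\psi)\to([s]^{\mathcal O}_i\varphi\to[t\cdot s]^{\mathcal O}_i\psi)$; $[t]^{\mathcal O}_i\varphi\to\langle t\rangle^{\mathcal P}_i\varphi$; $[\ddagger t]^{\mathcal O}_i([t]^{\mathcal O}_i\varphi\to\varphi)$. **Constant specifications.** A constant specification $\mathrm{CS}$ is a set of formulas of the form $[c_n]_{i_n}\cdots[c_1]_{i_1}\varphi$ or $[c_n]^{\mathcal O}_{i_n}\cdots[c_1]^{\mathcal O}_{i_1}\varphi$ with $n\ge1$, $c_k\in\mathrm{Const}$, $i_k\in\mathrm{Ag}$, $\varphi$ an axiom instance, which is downward closed: for $n>1$, if such a formula is in $\mathrm{CS}$, so is the one obtained by deleting its outermost operator. **Derivability.** $\vdash_{\mathrm{CS}}$ is derivability in the Hilbert system $\mathsf{JTO}_{\mathrm{CS}}$ with these axioms, modus ponens, necessitation (from $\vdash\varphi$ infer $\vdash\ast\varphi$) for $\ast\in\{\bigcirc,\mathsf Y_w,\Box,\blacksquare\}$, and: infer $\vdash\varphi$ for each $\varphi\in\mathrm{CS}$. $T\vdash_{\mathrm{CS}}\varphi$ means $\vdash_{\mathrm{CS}}(\psi_1\wedge\dots\wedge\psi_k)\to\varphi$ for some $\psi_1,\dots,\psi_k\in T$. *)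

(* Defs.v *)
From mathcomp Require Import all_boot.
From Stdlib Require List.

Set Implicit Arguments.
Unset Strict Implicit.
Unset Printing Implicit Defensive.

(* Protagoras, Euathlus and the judge. *)
Inductive agent := Protagoras | Euathlus | Judge.

Inductive eterm (C V : Type) : Type :=
  | EConst of C
  | EVar of V
  | EBang of eterm C V
  | ESum of eterm C V & eterm C V
  | EApp of eterm C V & eterm C V.

Inductive nterm (C V : Type) : Type :=
  | NConst of C
  | NVar of V
  | NDdag of nterm C V
  | NApp of nterm C V & nterm C V.

Arguments EConst {C V}.
Arguments EVar {C V}.
Arguments NConst {C V}.
Arguments NVar {C V}.

Inductive form (C V A : Type) : Type :=
  | Atom of A
  | Bot
  | Imp of form C V A & form C V A
  | Next of form C V A
  | Yw of form C V A
  | Until of form C V A & form C V A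
  | Since of form C V A & form C V A
  | Just of eterm C V & agent & form C V A
  | Obl of nterm C V & agent & form C V A.

Arguments Atom {C V A}.
Arguments Bot {C V A}.

Declare Scope jto_scope.
Delimit Scope jto_scope with jto.
Bind Scope jto_scope with form.

Notation "f `=> g" := (Imp f g) (at level 60, right associativity) : jto_scope.
Notation "f `U g" := (Until f g) (at level 45, no associativity) : jto_scope.
Notation "f `S g" := (Since f g) (at level 45, no associativity) : jto_scope.

Local Open Scope jto_scope.

Definition Neg (C V A : Type) (f : form C V A) := f `=> Bot.
Notation "`~ f" := (Neg f) (at level 35, right associativity) : jto_scope.

Definition Top {C V A : Type} : form C V A := `~ Bot.

Definition Or (C V A : Type) (f g : form C V A) := `~ f `=> g.
Notation "f `\/ g" := (Or f g) (at level 55, right associativity) : jto_scope.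

Definition And (C V A : Type) (f g : form C V A) := `~ (`~ f `\/ `~ g).
Notation "f `/\ g" := (And f g) (at level 51, right associativity) : jto_scope.

Definition Iff (C V A : Type) (f g : form C V A) := (f `=> g) `/\ (g `=> f).
Notation "f `<=> g" := (Iff f g) (at level 65, no associativity) : jto_scope.

Definition Ys (C V A : Type) (f : form C V A) := `~ Yw (`~ f).
Definition Diamond (C V A : Type) (f : form C V A) := Top `U f.
Definition Box (C V A : Type) (f : form C V A) := `~ Diamond (`~ f).
Definition PastBox (C V A : Type) (f : form C V A) := `~ (Top `S `~ f).
Definition Always (C V A : Type) (f : form C V A) := PastBox f `/\ Box f.
Definition Perm (C V A : Type) (s : nterm C V) (i : agent) (f : form C V A) :=
  `~ Obl s i (`~ f).

Definition time_is {C V A : Type} (m : nat) : form C V A :=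
  iter m (@Ys C V A) (Yw Bot).
Definition true_at (C V A : Type) (m : nat) (f : form C V A) :=
  Always (time_is m `=> f).

(* A valuation is an arbitrary assignment of truth values to all formulas; only
   its values on formulas that are neither Bot nor an implication are used, so
   these are the propositional atoms. *)
Fixpoint tt_eval (C V A : Type) (v : form C V A -> bool) (f : form C V A) :
    bool :=
  match f with
  | Bot => false
  | Imp g h => tt_eval v g ==> tt_eval v h
  | _ => v f
  end.

Definition tautology (C V A : Type) (f : form C V A) : Prop :=
  forall v : form C V A -> bool, tt_eval v f.

(* The modalities which are normal: axiom K and necessitation. *)
Inductive normal_op (C V A : Type) : (form C V A -> form C V A) -> Prop :=
  | normal_Next : normal_op (@Next C V A)
  | normal_Box : normal_op (@Box C V A)
  | normal_PastBox : normal_op (@PastBox C V A)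
  | normal_Yw : normal_op (@Yw C V A).

Inductive jto_axiom (C V A : Type) : form C V A -> Prop :=
  | ax_taut f : tautology f -> jto_axiom f
  | ax_K op f g : normal_op op ->
      jto_axiom (op (f `=> g) `=> (op f `=> op g))
  | ax_next_fun f : jto_axiom (Next (`~ f) `<=> `~ Next f)
  | ax_box_ind f : jto_axiom (Box (f `=> Next f) `=> (f `=> Box f))
  | ax_until_diamond f g : jto_axiom ((f `U g) `=> Diamond g)
  | ax_until_fix f g :
      jto_axiom ((f `U g) `<=> (g `\/ (f `/\ Next (f `U g))))
  | ax_strong_weak f : jto_axiom (Ys f `=> Yw f)
  | ax_initial : jto_axiom (Top `S Yw Bot)
  | ax_past_ind f : jto_axiom (PastBox (f `=> Yw f) `=> (f `=> PastBox f))
  | ax_since_once f g : jto_axiom ((f `S g) `=> (Top `S g))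
  | ax_since_fix f g :
      jto_axiom ((f `S g) `<=> (g `\/ (f `/\ Ys (f `S g))))
  | ax_next_prev f : jto_axiom (f `=> Next (Ys f))
  | ax_prev_next f : jto_axiom (f `=> Yw (Next f))
  | ax_just_app t s i f g :
      jto_axiom (Just t i (f `=> g) `=> (Just s i f `=> Just (EApp t s) i g))
  | ax_just_suml t s i f : jto_axiom (Just t i f `=> Just (ESum t s) i f)
  | ax_just_sumr t s i f : jto_axiom (Just s i f `=> Just (ESum t s) i f)
  | ax_just_fact t i f : jto_axiom (Just t i f `=> f)
  | ax_just_bang t i f :
      jto_axiom (Just t i f `=> Just (EBang t) i (Just t i f))
  | ax_obl_app t s i f g :
      jto_axiom (Obl t i (f `=> g) `=> (Obl s i f `=> Obl (NApp t s) i g))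
  | ax_obl_perm t i f : jto_axiom (Obl t i f `=> Perm t i f)
  | ax_obl_dag t i f : jto_axiom (Obl (NDdag t) i (Obl t i f `=> f)).

(* For l = [:: (c_n, i_n); ...; (c_1, i_1)], the formulas
   [c_n]_(i_n) ... [c_1]_(i_1) f and their normative counterparts. *)
Definition just_prefix (C V A : Type) (l : seq (C * agent)) (f : form C V A) :=
  foldr (fun ci g => Just (EConst ci.1) ci.2 g) f l.
Definition obl_prefix (C V A : Type) (l : seq (C * agent)) (f : form C V A) :=
  foldr (fun ci g => Obl (NConst ci.1) ci.2 g) f l.

Record constant_specification (C V A : Type) (CS : form C V A -> Prop) : Prop :=
  ConstantSpecification {
    cs_shape : forall f, CS f ->
      exists ci l g, jto_axiom g /\
        (f = just_prefix (ci :: l) g \/ f = obl_prefix (ci :: l) g);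
    cs_down_just : forall ci cj l g, jto_axiom g ->
      CS (just_prefix [:: ci, cj & l] g) -> CS (just_prefix (cj :: l) g);
    cs_down_obl : forall ci cj l g, jto_axiom g ->
      CS (obl_prefix [:: ci, cj & l] g) -> CS (obl_prefix (cj :: l) g)
  }.

Inductive provable (C V A : Type) (CS : form C V A -> Prop) :
    form C V A -> Prop :=
  | pr_ax f : jto_axiom f -> provable CS f
  | pr_mp f g : provable CS (f `=> g) -> provable CS f -> provable CS g
  | pr_nec op f : normal_op op -> provable CS f -> provable CS (op f)
  | pr_cs f : CS f -> provable CS f.

(* Right-nested, with empty conjunction Top. *)
Fixpoint conjunction (C V A : Type) (l : seq (form C V A)) : form C V A :=
  match l with
  | [::] => Top
  | [:: f] => f
  | f :: l' => f `/\ conjunction l'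
  end.

Definition derives (C V A : Type) (CS T : form C V A -> Prop)
    (f : form C V A) : Prop :=
  exists l : seq (form C V A),
    (forall g, List.In g l -> T g) /\ provable CS (conjunction l `=> f).

Definition PsueE (C V A : Type) (a : V) (sue_p pay winfirst_e : A) :
    form C V A :=
  Always (Perm (NVar a) Protagoras (Atom sue_p) `<=>
    (Ys (`~ Atom pay `S Atom winfirst_e) `/\ `~ Atom pay)).

(* Main.v *)
(** If [time = 15] now, the [time = 10] point lies exactly five steps back, so
    [winfirst_e] holds there.  Since [pay] is false at all points up to now, the
    formula [~ pay S Yw winfirst_e] holds one step after that point and
    propagates forward to the previous point, which triggers the second verdict.
    This is an argument local to a point, except that [time = 10 -> winfirst_e]
    is needed five steps back: an [Always] hypothesis can be moved back because
    [Always f -> Always (Yw f)] is derivable. *)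
Require Import Defs.
From mathcomp Require Import all_boot.
From Stdlib Require List.

Local Open Scope jto_scope.

Lemma provable_conseq1 {C V A} {CS : form C V A -> Prop} {f g} :
  provable CS f -> (forall v, tt_eval v f ==> tt_eval v g) -> provable CS g.
Proof. by move=> pf fg; apply: pr_mp pf; apply/pr_ax/ax_taut. Qed.

Lemma provable_conseq2 {C V A} {CS : form C V A -> Prop} {f g h} :
  provable CS f -> provable CS g ->
  (forall v, tt_eval v f ==> (tt_eval v g ==> tt_eval v h)) -> provable CS h.
Proof.
by move=> pf pg fgh; apply: pr_mp pg; apply: pr_mp pf; apply/pr_ax/ax_taut.
Qed.

(** Generic formulas get stuck as [tt_eval v f], atoms and modal formulas as [v f]; each is split on
    as an independent Boolean variable. *)
Ltac truth_table :=
  let v := fresh "v" in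
  intro v; simpl;
  repeat match goal with
    | |- context [tt_eval v ?f] => case: (tt_eval v f)
    | |- context [v ?f] => case: (v f)
    end.

Lemma provable_trans {C V A} {CS : form C V A -> Prop} {f} g {h} :
  provable CS (f `=> g) -> provable CS (g `=> h) -> provable CS (f `=> h).
Proof. by move=> fg gh; apply: (provable_conseq2 fg gh); truth_table. Qed.

Lemma provable_uncurry {C V A} {CS : form C V A -> Prop} {f g h} :
  provable CS (f `=> (g `=> h)) -> provable CS (f `/\ g `=> h).
Proof. by move=> fgh; apply: (provable_conseq1 fgh); truth_table. Qed.

Lemma provable_and {C V A} {CS : form C V A -> Prop} {f g h} :
  provable CS (f `=> g) -> provable CS (f `=> h) -> provable CS (f `=> g `/\ h).
Proof. by move=> fg fh; apply: (provable_conseq2 fg fh); truth_table. Qed.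

Lemma normal_mono {C V A} {CS : form C V A -> Prop} {op f g} :
  normal_op op -> provable CS (f `=> g) -> provable CS (op f `=> op g).
Proof.
by move=> nop fg; apply: pr_mp (pr_nec nop fg); apply/pr_ax/ax_K.
Qed.

Lemma normal_mono2 {C V A} {CS : form C V A -> Prop} {op f g h} :
  normal_op op -> provable CS (f `=> (g `=> h)) ->
  provable CS (op f `=> (op g `=> op h)).
Proof.
move=> nop fgh; apply: provable_trans (normal_mono nop fgh) _.
exact/pr_ax/ax_K.
Qed.

(** [Ys] is the dual of [Yw], so the implication is contraposed, pushed through [Yw] by axiom K, and
    contraposed back. *)
Lemma Yw_Ys_mono {C V A} {CS : form C V A -> Prop} {f g h} :
  provable CS (f `=> (g `=> h)) -> provable CS (Yw f `=> (Ys g `=> Ys h)).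
Proof.
move=> fgh.
have contra : provable CS (f `=> (`~ h `=> `~ g)).
  by apply: (provable_conseq1 fgh); truth_table.
have Yw_contra := normal_mono2 (normal_Yw _ _ _) contra.
by apply: (provable_conseq1 Yw_contra); truth_table.
Qed.

Lemma Yw_Ys_iter_mono {C V A} {CS : form C V A -> Prop} n f g :
  provable CS (iter n (@Yw C V A) (f `=> g) `=>
    (iter n (@Ys C V A) f `=> iter n (@Ys C V A) g)).
Proof.
by elim: n => [|n IHn]; [apply/pr_ax/ax_taut; truth_table | exact: Yw_Ys_mono].
Qed.

Lemma Box_now {C V A} {CS : form C V A -> Prop} f : provable CS (Box f `=> f).
Proof.
by apply: (provable_conseq1 (pr_ax _ (ax_until_fix Top (`~ f)))); truth_table.
Qed.

(** The fixed-point axiom refutes [Next] of the [Diamond] formula; functionality of [Next] then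
    moves that negation inside. *)
Lemma Box_Next {C V A} {CS : form C V A -> Prop} f :
  provable CS (Box f `=> Next (Box f)).
Proof.
apply: (provable_conseq2 (pr_ax _ (ax_until_fix Top (`~ f)))
  (pr_ax _ (ax_next_fun (Diamond (`~ f))))).
by truth_table.
Qed.

Lemma PastBox_now {C V A} {CS : form C V A -> Prop} f :
  provable CS (PastBox f `=> f).
Proof.
by apply: (provable_conseq1 (pr_ax _ (ax_since_fix Top (`~ f)))); truth_table.
Qed.

(** The [Ys] in the fixed-point axiom for [Since] unfolds to the negation of [Yw (PastBox f)], so
    the step is purely propositional. *)
Lemma PastBox_Yw {C V A} {CS : form C V A -> Prop} f :
  provable CS (PastBox f `=> Yw (PastBox f)).
Proof.
by apply: (provable_conseq1 (pr_ax _ (ax_since_fix Top (`~ f)))); truth_table.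
Qed.

Lemma Box_induction {C V A} {CS : form C V A -> Prop} {f} :
  provable CS (f `=> Next f) -> provable CS (f `=> Box f).
Proof.
by move/(pr_nec (normal_Box _ _ _)); apply: pr_mp; apply/pr_ax/ax_box_ind.
Qed.

Lemma PastBox_induction {C V A} {CS : form C V A -> Prop} {f} :
  provable CS (f `=> Yw f) -> provable CS (f `=> PastBox f).
Proof.
by move/(pr_nec (normal_PastBox _ _ _)); apply: pr_mp; apply/pr_ax/ax_past_ind.
Qed.

Lemma Always_mono2 {C V A} {CS : form C V A -> Prop} {f g h} :
  provable CS (f `=> (g `=> h)) ->
  provable CS (Always f `=> (Always g `=> Always h)).
Proof.
move=> fgh.
have past := normal_mono2 (normal_PastBox _ _ _) fgh.
have future := normal_mono2 (normal_Box _ _ _) fgh.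
by apply: (provable_conseq2 past future); truth_table.
Qed.

Lemma Always_mono3 {C V A} {CS : form C V A -> Prop} {f g h k} :
  provable CS (f `=> (g `=> (h `=> k))) ->
  provable CS (Always f `=> (Always g `=> (Always h `=> Always k))).
Proof.
move/Always_mono2 => fgK.
have Kh : provable CS (Always (h `=> k) `=> (Always h `=> Always k)).
  by apply: Always_mono2; apply/pr_ax/ax_taut; truth_table.
(* Made opaque, the implication is a single variable of the truth table. *)
move: (Always h `=> _) Kh => K Kh.
by apply: (provable_conseq2 fgK Kh); truth_table.
Qed.

(** At earlier points [PastBox f] persists and yields [Yw f]. Later points are reached by induction
    from the present, where [PastBox f] supplies [Yw f]. *)
Lemma Always_Yw {C V A} {CS : form C V A -> Prop} f :
  provable CS (Always f `=> Always (Yw f)).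
Proof.
have Yw_now : provable CS (PastBox f `=> Yw f).
  apply: provable_trans (PastBox_Yw f) _.
  exact: normal_mono (normal_Yw _ _ _) (PastBox_now f).
have past : provable CS (PastBox f `=> PastBox (Yw f)).
  apply: provable_trans (PastBox_induction (PastBox_Yw f)) _.
  exact: normal_mono (normal_PastBox _ _ _) Yw_now.
have now_next : provable CS (f `=> Next (Yw f)).
  apply: provable_trans (pr_ax _ (ax_next_prev f)) _.
  exact: normal_mono (normal_Next _ _ _) (pr_ax _ (ax_strong_weak f)).
(* [Yw f] alone need not persist; with [Box f], [f] holds now, which makes [Yw f] true at the next
   point. *)
have invariant : provable CS (Yw f `/\ Box f `=> Next (Yw f `/\ Box f)).
  have pair : provable CS (Yw f `=> (Box f `=> Yw f `/\ Box f)).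
    by apply/pr_ax/ax_taut; truth_table.
  have next_Yw := provable_trans _ (Box_now f) now_next.
  have next_pair := normal_mono2 (normal_Next _ _ _) pair.
  have Box_pair : provable CS (Box f `=> Next (Yw f `/\ Box f)).
    move: (provable_and next_Yw (Box_Next f)) (provable_uncurry next_pair).
    exact: provable_trans.
  by apply: (provable_conseq1 Box_pair); truth_table.
have future : provable CS (Yw f `/\ Box f `=> Box (Yw f)).
  apply: provable_trans (Box_induction invariant) _.
  apply: normal_mono (normal_Box _ _ _) _.
  by apply/pr_ax/ax_taut; truth_table.
have Always_future : provable CS (Always f `=> Box (Yw f)).
  by apply: (provable_conseq2 Yw_now future); truth_table.
by apply: (provable_conseq2 past Always_future); truth_table.
Qed.

Lemma Always_iter_Yw {C V A} {CS : form C V A -> Prop} n f :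
  provable CS (Always f `=> Always (iter n (@Yw C V A) f)).
Proof.
elim: n => [|n IHn]; first by apply/pr_ax/ax_taut; truth_table.
exact: provable_trans IHn (Always_Yw _).
Qed.

(** The witness for [Since] lies [n] steps back, since its [Yw] accounts for one of the [n.+1]
    steps. Induction shifts the claim back by one point and then uses [f] now to extend [Since]
    forward. *)
Lemma PastBox_Ys_iter_Since {C V A} {CS : form C V A -> Prop} n f g :
  provable CS (PastBox f `=> (iter n.+1 (@Ys C V A) g `=> (f `S Yw g))).
Proof.
have fix_axiom := pr_ax CS (ax_since_fix f (Yw g)).
elim: n => [|n IHn] /=.
  apply: (provable_conseq2 (pr_ax CS (ax_strong_weak g)) fix_axiom).
  by truth_table.
have prev := provable_trans _ (PastBox_Yw f) (Yw_Ys_mono IHn).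
have unfold : provable CS (f `=> (Ys (f `S Yw g) `=> (f `S Yw g))).
  by apply: (provable_conseq1 fix_axiom); truth_table.
have now := provable_trans _ (PastBox_now f) unfold.
by apply: (provable_conseq2 prev now); truth_table.
Qed.

Theorem theorem7p9 (C V A : countType) (a : V)
    (winfirst_e pay sue_p winsecond_p : A)
    (distinct_atoms : uniq [:: winfirst_e; pay; sue_p; winsecond_p])
    (CS : form C V A -> Prop) (hCS : constant_specification CS) :
  derives CS
    (fun f : form C V A => List.In f
       [:: true_at 10 (Atom winfirst_e);
           true_at 15 (PastBox (`~ Atom pay));
           PsueE C a sue_p pay winfirst_e;
           true_at 15
             ((Ys (`~ Atom pay `S Yw (Atom winfirst_e)) `/\ `~ Atom pay)
               `=> Atom winsecond_p)])
    (true_at 15 (Atom winsecond_p)).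
Proof.
set win := Atom winfirst_e; set win2 := Atom winsecond_p.
set unpaid := `~ Atom pay.
set rule := (X in true_at 15 (X `=> win2)).
exists [:: true_at 10 win; true_at 15 (PastBox unpaid);
           true_at 15 (rule `=> win2)].
split; first by move=> f /=; tauto.
have local_rule : provable CS (PastBox unpaid `=>
    (iter 5 (@Ys C V A) win `=> rule)).
  (* One of the five steps is the outer [Ys] of [rule]; the other four are [n.+1] with [n = 3]. *)
  have prev := provable_trans _ (PastBox_Yw (CS := CS) unpaid)
    (Yw_Ys_mono (PastBox_Ys_iter_Since 3 unpaid win)).
  apply: (provable_conseq2 prev (PastBox_now unpaid)).
  by rewrite /rule; truth_table.
have local : provable CS (iter 5 (@Yw C V A) (time_is 10 `=> win) `=>
    ((time_is 15 `=> PastBox unpaid) `=>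
      ((time_is 15 `=> (rule `=> win2)) `=> (time_is 15 `=> win2)))).
  (* [time_is 15] is convertible to [iter 5] of [Ys] on [time_is 10], hence the five steps. *)
  have shift : provable CS (iter 5 (@Yw C V A) (time_is 10 `=> win) `=>
    (time_is 15 `=> iter 5 (@Ys C V A) win)) := Yw_Ys_iter_mono 5 _ _.
  move: (iter 5 _ win) (iter 5 _ (_ `=> _)) (time_is 15) rule (PastBox _)
    local_rule shift => w y t r p local_rule shift.
  by apply: (provable_conseq2 local_rule shift); truth_table.
have main := provable_trans _ (Always_iter_Yw 5 _) (Always_mono3 local).
move: main; rewrite /conjunction /true_at.
(* Only currying separates [main] from the goal, so the four [Always] formulas can become
   variables. *)
move: (Always _) (Always _) (Always _) (Always _) => f1 f2 f3 f4 main.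
by apply: (provable_conseq1 main); truth_table.
Qed.
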